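(* Let $(X_t)_{t \in \mathbb{N}}$ be a random process over $\mathbb{R}$, let $x_{\min} \geq 0$, and let $T = \inf\{t \mid X_t \leq x_{\min}\}$. Additionally, let $D$ denote the smallest real interval that contains $x_{\min}$ and at least all values $x \geq x_{\min}$ that, for all $t \leq T$, any $X_t$ can take. Furthermore, suppose that, (a) for all $t \leq T$, it holds that $X_t \geq x_{\min}$, and that (b) there is a monotonically increasing function $h\colon D \to \mathbb{R}^+$ such that, for all $t < T$, we have $X_t - \mathrm{E}[X_{t+1} \mid X_0, \ldots, X_t] \geq h(X_t)$. Then $$\mathrm{E}[T \mid X_0] \leq \int_{x_{\min}}^{X_0} \frac{1}{h(z)} \,\mathrm{d}z.$$
   Context: $\mathbb{N}$ includes $0$; $\mathbb{R}^+$ denotes the positive reals. $\inf\emptyset := \infty$, so $T$ takes values in $\mathbb{N} \cup \{\infty\}$. The interval $D$ contains (at least) all possible values that the process can take while not having reached $x_{\min}$ yet. Conditional expectations given $X_0,\ldots,X_t$ (respectively $X_0$) are random variables, taken with respect to the $\sigma$-algebra generated by these variables; (in)equalities between random variables are understood almost surely. Since $T$ is a random variable, a requirement stated ''for all $t < T$'' (respectively ''for all $t \le T$'') means formally that, for every $t \in \mathbb{N}$, both sides of the inequality are multiplied by the indicator function of the event $\{t < T\}$ (respectively $\{t \le T\}$); i.e., the inequality only has to hold on that event. *)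

(* Defs.v *)
From HB Require Import structures.
From mathcomp Require Import all_boot all_order all_algebra.
From mathcomp Require Import all_classical all_reals all_analysis.
From mathcomp Require Import measurable_realfun.

Set Implicit Arguments.
Unset Strict Implicit.
Unset Printing Implicit Defensive.

Import Order.TTheory GRing.Theory Num.Theory.
Import numFieldNormedType.Exports.

Local Open Scope classical_set_scope.
Local Open Scope ring_scope.

Definition sigma_upto d (Omega : measurableType d) (R : realType)
    (X : nat -> Omega -> R) (t : nat) : set (set Omega) :=
  g_sigma_preimage (fun i : 'I_t.+1 => X i).

(* [Y] is a version of E[Z | G] for [Z >= 0], with values in [0, +oo];
   [Z] need not be integrable. *)
Definition is_cond_exp_ge0 d (Omega : measurableType d) (R : realType)
    (P : probability Omega R) (G : set (set Omega)) (Z Y : Omega -> \bar R) :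
    Prop :=
  [/\ forall B : set (\bar R), measurable B -> G (Y @^-1` B),
      forall w, (0 <= Y w)%E &
      forall A, G A -> (\int[P]_(w in A) Y w = \int[P]_(w in A) Z w)%E].

(* [Y] is a version of E[Z | G] := E[Z^+ | G] - E[Z^- | G].  It is meaningful at
   the points where the two terms are not both infinite (in \bar R,
   +oo - +oo is the junk value -oo); this holds almost everywhere when [Z] is
   integrable, and on every event of [G] on which [Z >= 0] almost surely. *)
Definition is_cond_exp d (Omega : measurableType d) (R : realType)
    (P : probability Omega R) (G : set (set Omega)) (Z Y : Omega -> \bar R) :
    Prop :=
  exists Yp Yn : Omega -> \bar R,
    [/\ is_cond_exp_ge0 P G (Z^\+)%E Yp,
        is_cond_exp_ge0 P G (Z^\-)%E Yn &
        forall w, (Y w = Yp w - Yn w)%E].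

(* The infimum is taken in \bar R, so it is +oo on the empty set. *)
Definition hitting_time (Omega : Type) (R : realType)
    (X : nat -> Omega -> R) (xmin : R) (w : Omega) : \bar R :=
  ereal_inf [set (t%:R)%:E | t in [set t : nat | X t w <= xmin]].

Definition values_upto_hitting (Omega : Type) (R : realType)
    (X : nat -> Omega -> R) (xmin : R) : set R :=
  [set x | xmin <= x /\
     exists (w : Omega) (t : nat),
       ((t%:R)%:E <= hitting_time X xmin w)%E /\ X t w = x].

Definition drift_domain (Omega : Type) (R : realType)
    (X : nat -> Omega -> R) (xmin : R) : set R :=
  smallest (@is_interval R) (xmin |` values_upto_hitting X xmin).

(* Main.v *)
Require Import Defs.
From HB Require Import structures.
From mathcomp Require Import all_boot all_order all_algebra.
From mathcomp Require Import all_classical all_reals all_analysis.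
From mathcomp Require Import measurable_realfun.
From mathcomp Require Import lra.

Set Implicit Arguments.
Unset Strict Implicit.
Unset Printing Implicit Defensive.

Import Order.TTheory GRing.Theory Num.Theory.
Import numFieldNormedType.Exports.

Local Open Scope classical_set_scope.
Local Open Scope ring_scope.

(** Write [phi] for [1 / h] and let [g x] be the integral of [phi] over
    [[xmin, x]].  Since [phi] is
    nonincreasing, [g] is concave, with slope [phi x] at [x]; hence
    [g y <= g x + phi x * (y - x)] for all [x, y >= xmin]
    ([potential_tangent]).  Taking [x = X_t], [y = X_{t+1}] and conditional
    expectations on the event [t < T], the drift condition gives
    [E[g(X_{t+1}) | X_0, ..., X_t] <= g(X_t) - phi(X_t) h(X_t) = g(X_t) - 1]:
    the variable drift condition becomes an additive drift of [1] for the
    potential [g].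

    Conditional expectations only enter through integrals over the events of
    the history.  For such an event [L] contained in [t < T], the inequality
    above reads [P L + int_L g(X_{t+1}) <= int_L g(X_t)]
    ([potential_drift]).  The one measure-theoretic point is that the factor
    [phi(X_t)] can be pulled out of the conditional expectation
    ([ge0_integral_pull_out]).  Taking [L = A /\ {t < T}] with [A] an event of
    [X_0] and summing over [t < n] bounds the sum of the [P (A /\ {t < T})] by
    [int_A g(X_0)] ([partial_hitting_time_le]).  As [T] is the sum over all
    [t] of the indicators of [t < T] ([hitting_timeE]), monotone convergence
    yields [int_A T <= int_A g(X_0)] ([integral_hitting_time_le]).

    All integrands are nonnegative, so every integral makes sense, possibly as
    [+oo]; the events [A] are kept inside [X_0 <= k], where the integrals that
    have to be cancelled are finite.  Finally, the integral inequality is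
    applied to the events [E[T | X_0] > g(X_0), X_0 <= k]: they are all null
    ([null_of_integral_le]), which is the claim. *)

(** * The potential function *)

Section potential.
Variables (R : realType) (phi : R -> R) (a : R).
Hypothesis phi_ge0 : forall x, 0 <= phi x.
Hypothesis phi_ni : forall x y, x <= y -> phi y <= phi x.

Definition potential (x : R) : R :=
  \int[lebesgue_measure]_(z in `[a, x]) phi z.

Lemma phi_integrable (b c : R) :
  lebesgue_measure.-integrable `[b, c] (EFin \o phi).
Proof.
apply: measurable_bounded_integrable => //.
- by rewrite /= lebesgue_measure_itv/=; case: ifP => // _; rewrite -EFinB ltry.
- by apply: nonincreasing_measurable => // x y xy; exact: phi_ni.
- exists (phi b); split; first exact: num_real.
  move=> M bM x /=; rewrite in_itv/= => /andP[bx _].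
  by rewrite ger0_norm// (le_trans (phi_ni bx))// ltW.
Qed.

(** A nonincreasing integrand lies between its values at the end points. *)
Lemma potential_increment_bounds (x y : R) : a <= x -> x <= y ->
  phi y * (y - x) <= potential y - potential x <= phi x * (y - x).
Proof.
move=> ax xy; rewrite /potential Rintegral_itvB ?bnd_simp//;
  last exact: phi_integrable.
have iphi : lebesgue_measure.-integrable `]x, y] (EFin \o phi).
  apply: integrableS (phi_integrable x y) => //.
  by apply: subset_itvr; rewrite bnd_simp.
have muE : fine (lebesgue_measure `]x, y]) = y - x.
  rewrite lebesgue_measure_itv/= lte_fin; case: ltP => // yx.
  by rewrite (@le_anti _ _ x y) ?subrr ?xy.
have icst r : lebesgue_measure.-integrable `]x, y] (EFin \o cst r).
  apply: measurable_bounded_integrable => //.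
    rewrite /= lebesgue_measure_itv/=.
    by case: ifP => // _; rewrite -EFinB ltry.
  by exists `|r|; split; [exact: num_real|move=> M rM z _; exact: ltW].
rewrite -muE -!Rintegral_cst//.
apply/andP; split.
  apply: le_Rintegral => //; first exact: (icst (phi y)).
  by move=> z /=; rewrite in_itv/= => /andP[_ zy]; exact: phi_ni.
apply: le_Rintegral => //; first exact: (icst (phi x)).
by move=> z /=; rewrite in_itv/= => /andP[/ltW xz _]; exact: phi_ni.
Qed.

(** Concavity: the graph lies below the line of slope [phi x] through the point
    at [x].  In this form all four terms are nonnegative when [0 <= a], so the
    inequality can be integrated term by term. *)
Lemma potential_tangent (x y : R) : a <= x -> a <= y ->
  potential y + phi x * x <= potential x + phi x * y.
Proof.
move=> ax ay; have [xy|/ltW yx] := leP x y.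
- by have /andP[_] := potential_increment_bounds ax xy; lra.
- by have /andP[+ _] := potential_increment_bounds ay yx; lra.
Qed.

Lemma potential_ge0 x : 0 <= potential x.
Proof. exact: Rintegral_ge0. Qed.

Lemma potential_nd : {homo potential : x y / x <= y}.
Proof.
move=> x y xy; have [ax|xa] := leP a x; last first.
  rewrite {1}/potential set_itv_ge ?Rintegral_set0 ?potential_ge0//.
  by rewrite bnd_simp -ltNge.
have /andP[+ _] := potential_increment_bounds ax xy.
have : 0 <= phi y * (y - x) by rewrite mulr_ge0 ?subr_ge0.
by lra.
Qed.

Lemma measurable_potential : measurable_fun setT potential.
Proof. by apply: nondecreasing_measurable => // x y; exact: potential_nd. Qed.

Lemma potentialE x :
  ((potential x)%:E = \int[lebesgue_measure]_(z in `[a, x]) (phi z)%:E)%E.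
Proof.
rewrite /potential /Rintegral fineK//; apply: integrable_fin_num => //.
exact: phi_integrable.
Qed.

End potential.

(** * Taking out what is known *)

Section pull_out.
Context d1 d2 (T1 : measurableType d1) (T2 : measurableType d2) (R : realType).
Variables (mu : {measure set T1 -> \bar R}) (V : T1 -> T2) (B : set T2).
Hypotheses (mV : measurable_fun setT V) (mB : measurable B).

Import HBNNSimple.

Local Open Scope ereal_scope.

Lemma ge0_integral_nnsfun_mul (f : {nnsfun T2 >-> R}) (Y : T1 -> R) :
  measurable_fun setT Y -> (forall x, 0 <= Y x)%R ->
  \int[mu]_(x in V @^-1` B) (f (V x) * Y x)%:E =
  \sum_(r \in range f)
    r%:E * \int[mu]_(x in V @^-1` (B `&` f @^-1` [set r])) (Y x)%:E.
Proof.
move=> mY Y0.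
have mVB A : measurable A -> measurable (V @^-1` A).
  by move=> mA; rewrite -[_ @^-1` _]setTI; exact: mV.
have mfr r : measurable (f @^-1` [set r]) by exact: measurable_sfunP.
transitivity (\int[mu]_(x in V @^-1` B) (\sum_(r \in range f)
    (r%:E * (\1_(f @^-1` [set r]) (V x))%:E) * (Y x)%:E)).
  apply: eq_integral => x _.
  rewrite -ge0_mule_fsuml => [|r]; last exact: nnfun_muleindic_ge0.
  by rewrite [f (V x)]fimfunE EFinM -fsumEFin.
have mI r :
    measurable_fun setT (fun x => (\1_(f @^-1` [set r]) (V x))%:E : \bar R).
  apply/measurable_EFinP; apply: measurableT_comp mV.
  exact: measurable_indic.
rewrite ge0_integral_fsum//; last 3 first.
- exact: mVB.
- move=> r; apply: measurable_funTS.
  apply: emeasurable_funM; last exact/measurable_EFinP.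
  exact: measurable_funeM.
- move=> r x _; apply: mule_ge0; last by rewrite lee_fin.
  exact: nnfun_muleindic_ge0.
apply: eq_fsbigr => r /[!inE] -[t _ <-].
under eq_integral do rewrite -muleA.
rewrite ge0_integralZl//.
- congr (_ * _); rewrite preimage_setI integral_mkcondr.
  apply: eq_integral => x _; rewrite patchE indicE.
  have -> : (V x \in f @^-1` [set f t]) = (x \in V @^-1` (f @^-1` [set f t])).
    by apply/idP/idP; rewrite !inE.
  by case: ifP => _; rewrite ?mul1e ?mul0e.
- exact: mVB.
- apply: measurable_funTS; apply: emeasurable_funM => //.
  exact/measurable_EFinP.
- by move=> x _; rewrite mule_ge0 ?lee_fin.
- by rewrite lee_fin.
Qed.

(** Simple functions of [V] are handled by the previous lemma, and monotone
    convergence extends the equality to all nonnegative measurable ones.  With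
    [V] the identity into a coarser measurable space, this is the rule
    [E[c Z | G] = c E[Z | G]].  Since [Y] and [Z] are finite-valued, limits of
    simple functions pass through the product with them. *)
Lemma ge0_integral_pull_out (c : T2 -> R) (Y Z : T1 -> R) :
  measurable_fun setT c -> (forall x, 0 <= c x)%R ->
  measurable_fun setT Y -> (forall x, 0 <= Y x)%R ->
  measurable_fun setT Z -> (forall x, 0 <= Z x)%R ->
  (forall A, measurable A -> A `<=` B ->
    \int[mu]_(x in V @^-1` A) (Y x)%:E = \int[mu]_(x in V @^-1` A) (Z x)%:E) ->
  \int[mu]_(x in V @^-1` B) (c (V x) * Y x)%:E =
  \int[mu]_(x in V @^-1` B) (c (V x) * Z x)%:E.
Proof.
move=> mc c0 mY Y0 mZ Z0 YZ.
have mVB : measurable (V @^-1` B) by rewrite -[_ @^-1` _]setTI; exact: mV.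
have mc' : measurable_fun setT (EFin \o c) by exact/measurable_EFinP.
pose f := nnsfun_approx measurableT mc'.
have lim_f (W : T1 -> R) : measurable_fun setT W -> (forall x, 0 <= W x)%R ->
    \int[mu]_(x in V @^-1` B) (c (V x) * W x)%:E =
    limn (fun n => \int[mu]_(x in V @^-1` B) (f n (V x) * W x)%:E).
  move=> mW W0; rewrite -monotone_convergence//.
  - apply: eq_integral => x _; apply/esym/cvg_lim => //.
    under eq_fun do rewrite EFinM.
    rewrite EFinM; apply: cvgeZr => //.
    by apply: (cvg_nnsfun_approx measurableT mc') => // ? _; rewrite lee_fin.
  - move=> n; apply: measurable_funTS; apply/measurable_EFinP.
    by apply: measurable_funM => //; apply: measurableT_comp mV.
  - by move=> n x _; rewrite lee_fin mulr_ge0.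
  - move=> x _ m n mn; rewrite lee_fin ler_wpM2r//.
    exact/lefP/nd_nnsfun_approx.
rewrite !lim_f//; congr (limn _); apply/funext => n.
rewrite !ge0_integral_nnsfun_mul//; apply: eq_fsbigr => r _; rewrite YZ//.
Qed.

End pull_out.

(** * One step of the drift argument *)

Lemma ae_ge0_le_integralD d (T : measurableType d) (R : realType)
    (mu : {measure set T -> \bar R}) (D : set T) (f1 f2 g1 g2 : T -> R) :
  measurable D ->
  measurable_fun D f1 -> measurable_fun D f2 ->
  measurable_fun D g1 -> measurable_fun D g2 ->
  (forall w, D w -> 0 <= f1 w) -> (forall w, D w -> 0 <= f2 w) ->
  (forall w, D w -> 0 <= g1 w) -> (forall w, D w -> 0 <= g2 w) ->
  {ae mu, forall w, D w -> f1 w + f2 w <= g1 w + g2 w} ->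
  (\int[mu]_(w in D) (f1 w)%:E + \int[mu]_(w in D) (f2 w)%:E <=
   \int[mu]_(w in D) (g1 w)%:E + \int[mu]_(w in D) (g2 w)%:E)%E.
Proof.
move=> mD mf1 mf2 mg1 mg2 f10 f20 g10 g20 fg.
rewrite -!ge0_integralD//; try exact/measurable_EFinP.
apply: ae_ge0_le_integral => //.
- by move=> w Dw; rewrite adde_ge0 ?lee_fin ?f10 ?f20.
- by apply: emeasurable_funD; exact/measurable_EFinP.
- by move=> w Dw; rewrite adde_ge0 ?lee_fin ?g10 ?g20.
- by apply: emeasurable_funD; exact/measurable_EFinP.
Qed.

(** In this section [V] is the history up to the current step, [B] an event of
    the history, [x] the current value, [y] the next one, and [Ey] its
    conditional expectation.  The truncation [max y 0] agrees almost surely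
    with [y] on the event, by [ay] and [a0], and is nonnegative everywhere. *)
Section one_step.
Context d1 d2 (T1 : measurableType d1) (T2 : measurableType d2) (R : realType).
Variables (P : {finite_measure set T1 -> \bar R}) (V : T1 -> T2) (B : set T2).
Hypotheses (mV : measurable_fun setT V) (mB : measurable B).
Variables (phi : R -> R) (a : R) (x : T2 -> R) (y Ey : T1 -> R).
Hypotheses (a0 : 0 <= a) (phi_ge0 : forall z, 0 <= phi z).
Hypothesis phi_ni : forall z1 z2, z1 <= z2 -> phi z2 <= phi z1.
Hypotheses (mx : measurable_fun setT x) (my : measurable_fun setT y).
Hypotheses (mEy : measurable_fun setT Ey) (Ey_ge0 : forall w, 0 <= Ey w).

Local Open Scope ereal_scope.

Hypothesis EyE : forall A, measurable A -> A `<=` B ->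
  \int[P]_(w in V @^-1` A) (Ey w)%:E =
  \int[P]_(w in V @^-1` A) (Num.max (y w) 0)%:E.
Hypothesis ax : forall v, B v -> (a <= x v)%R.
Hypothesis ay : {ae P, forall w, B (V w) -> (a <= y w)%R}.
Hypothesis drift : {ae P, forall w, B (V w) ->
  (phi (x (V w)) * Ey w + 1 <= phi (x (V w)) * x (V w))%R}.
Hypothesis x_fin : \int[P]_(w in V @^-1` B) (x (V w))%:E < +oo.

(** Integrating the tangent inequality leaves [int phi(x) x] on the left and
    [int phi(x) y] on the right; by the pull-out rule the latter is
    [int phi(x) Ey], which the drift bounds by [int phi(x) x - P B].  The
    integral of [phi(x) x] is then cancelled; it is finite because
    [phi(x) <= phi a] and [x] has a finite integral. *)
Lemma potential_drift :
  P (V @^-1` B) + \int[P]_(w in V @^-1` B) (potential phi a (y w))%:E <=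
  \int[P]_(w in V @^-1` B) (potential phi a (x (V w)))%:E.
Proof.
have mVB : measurable (V @^-1` B) by rewrite -[_ @^-1` _]setTI; exact: mV.
have mphi : measurable_fun setT phi.
  by apply: nonincreasing_measurable => // z1 z2; exact: phi_ni.
have mG := measurable_potential a phi_ge0 phi_ni.
have mxV : measurable_fun setT (x \o V) by exact: measurableT_comp.
have mc : measurable_fun setT (phi \o x) by exact: measurableT_comp.
have mcV : measurable_fun setT (phi \o x \o V) by exact: measurableT_comp.
have my0 : measurable_fun setT (fun w => Num.max (y w) 0)%R.
  exact: measurable_maxr.
have xV0 w : (V @^-1` B) w -> (0 <= x (V w))%R.
  by move=> /ax; exact: le_trans.
have G0 z : (0 <= potential phi a z)%R by exact: potential_ge0.
have mE (f : T1 -> R) : measurable_fun setT f -> measurable_fun (V @^-1` B) f.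
  exact: measurable_funTS.
have y0 w : (0 <= Num.max (y w) 0)%R by rewrite le_max lexx orbT.
have cfin : \int[P]_(w in V @^-1` B) (phi (x (V w)) * x (V w))%:E \is a fin_num.
  rewrite ge0_fin_numE; last first.
    by apply: integral_ge0 => w Bw; rewrite lee_fin mulr_ge0// xV0.
  apply: (@le_lt_trans _ _
    (\int[P]_(w in V @^-1` B) ((phi a)%:E * (x (V w))%:E))).
    apply: ge0_le_integral => //.
    - by move=> w Bw; rewrite lee_fin mulr_ge0// xV0.
    - by apply/measurable_EFinP/mE; exact: measurable_funM.
    - by apply: measurable_funeM; exact/measurable_EFinP/mE.
    - by move=> w Bw; rewrite -EFinM lee_fin ler_wpM2r ?xV0//; apply/phi_ni/ax.
  rewrite ge0_integralZl ?lee_fin//.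
  - by rewrite lte_mul_pinfty// lee_fin.
  - exact/measurable_EFinP/mE.
have tangent : \int[P]_(w in V @^-1` B) (potential phi a (y w))%:E +
      \int[P]_(w in V @^-1` B) (phi (x (V w)) * x (V w))%:E <=
    \int[P]_(w in V @^-1` B) (potential phi a (x (V w)))%:E +
      \int[P]_(w in V @^-1` B) (phi (x (V w)) * Num.max (y w) 0)%:E.
  apply: ae_ge0_le_integralD => //.
  - exact: mE (measurableT_comp mG my).
  - exact: mE (measurable_funM mcV mxV).
  - exact: mE (measurableT_comp mG mxV).
  - exact: mE (measurable_funM mcV my0).
  - by move=> w Bw; rewrite mulr_ge0// xV0.
  - by move=> w Bw; rewrite mulr_ge0.
  apply: filterS ay => w /[swap] Bw /(_ Bw) yw.
  rewrite max_l ?(le_trans a0)//.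
  by apply: potential_tangent => //; exact: ax.
have step :
    \int[P]_(w in V @^-1` B) (phi (x (V w)) * Ey w)%:E + P (V @^-1` B) <=
    \int[P]_(w in V @^-1` B) (phi (x (V w)) * x (V w))%:E.
  have -> : P (V @^-1` B) = \int[P]_(w in V @^-1` B) 1%:E.
    by rewrite integral_cst// mul1e.
  rewrite -[leRHS]adde0 -[X in _ <= _ + X](integral0 P (V @^-1` B)).
  apply: ae_ge0_le_integralD => //.
  - exact: mE (measurable_funM mcV mEy).
  - exact: mE (measurable_funM mcV mxV).
  - by move=> w Bw; rewrite mulr_ge0.
  - by move=> w Bw; rewrite mulr_ge0// xV0.
  - by apply: filterS drift => w; rewrite addr0.
have pull := ge0_integral_pull_out mV mB mc (fun v => phi_ge0 (x v)) mEy Ey_ge0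
  my0 y0 EyE.
rewrite pull in step.
move: tangent step cfin; set u := integral _ _ _; set v := integral _ _ _.
set w := integral _ _ _; set z := integral _ _ _ => uv zp vfin.
(* u + v <= w + z and z + P B <= v; add P B to the first and cancel v *)
rewrite -(@leeD2rE _ v)// -addeA addeC.
by rewrite (le_trans (leeD2r _ uv))// -addeA leeD2l.
Qed.

(** Keeps the finiteness assumption of [potential_drift] true from one step to
    the next. *)
Lemma integral_nonincrease : {ae P, forall w, B (V w) -> (Ey w <= x (V w))%R} ->
  \int[P]_(w in V @^-1` B) (Num.max (y w) 0)%:E <=
  \int[P]_(w in V @^-1` B) (x (V w))%:E.
Proof.
move=> Ex; rewrite -EyE//.
have mVB : measurable (V @^-1` B) by rewrite -[_ @^-1` _]setTI; exact: mV.
apply: ae_ge0_le_integral => //.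
- by move=> w _; rewrite lee_fin.
- by apply/measurable_EFinP/measurable_funTS.
- by move=> w Bw; rewrite lee_fin (le_trans a0)// ax.
- by apply/measurable_EFinP/measurable_funTS; exact: measurableT_comp.
Qed.

End one_step.

(** * The hitting time *)

Section hitting_time.
Variables (Omega : Type) (R : realType) (X : nat -> Omega -> R) (a : R).

Local Open Scope ereal_scope.

Definition unhit n : set Omega := [set w | n%:R%:E < hitting_time X a w].

Lemma hitting_timeP w :
  (exists n, [/\ hitting_time X a w = n%:R%:E, (X n w <= a)%R &
                 forall m, (m < n)%N -> (a < X m w)%R]) \/
  (hitting_time X a w = +oo /\ forall m, (a < X m w)%R).
Proof.
have [[n Xn]|nX] := pselect (exists n, (X n w <= a)%R); last first.
  right; split=> [|m]; last first.
    by rewrite ltNge; apply/negP => Xm; apply: nX; exists m.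
  rewrite /hitting_time (_ : [set _ | _ in _] = set0) ?ereal_inf0//.
  by rewrite -subset0 => _ [m /= Xm _]; apply: nX; exists m.
left; have [k Xk kmin] := @ex_minnP (fun m => (X m w <= a)%R) (ex_intro _ n Xn).
exists k; split=> // [|m mk]; last first.
  by rewrite ltNge; apply/negP => /kmin; rewrite leqNgt mk.
apply/eqP; rewrite eq_le; apply/andP; split.
  by apply: ereal_inf_lbound; exists k.
by apply: le_ereal_inf_tmp => _ [m /= /kmin km <-]; rewrite lee_fin ler_nat.
Qed.

Lemma lt_hitting_timeP n w :
  n%:R%:E < hitting_time X a w <-> forall m, (m <= n)%N -> (a < X m w)%R.
Proof.
have [[k [-> Xk Xm]]|[-> Xm]] := hitting_timeP w; last first.
  by split=> // _; rewrite ltry.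
rewrite lte_fin ltr_nat; split=> [nk m mn|]; first exact/Xm/(leq_ltn_trans mn).
by move=> Xn; rewrite ltnNge; apply/negP => /Xn; rewrite ltNge Xk.
Qed.

Lemma lt_hitting_time_le n w :
  n%:R%:E < hitting_time X a w -> n.+1%:R%:E <= hitting_time X a w.
Proof.
have [[k [-> _ _]]|[-> _]] := hitting_timeP w; last by rewrite leey.
by rewrite lte_fin ltr_nat lee_fin ler_nat.
Qed.

Lemma unhit_gt t w : unhit t w -> (a < X t w)%R.
Proof. by move=> /lt_hitting_timeP; exact. Qed.

Lemma unhitS t : unhit t.+1 `<=` unhit t.
Proof. by move=> w; apply: lt_trans; rewrite lte_fin ltr_nat. Qed.

Lemma hitting_time_ge0 w : 0 <= hitting_time X a w.
Proof.
by have [[k [-> _ _]]|[-> _]] := hitting_timeP w; rewrite ?leey// lee_fin.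
Qed.

(** The pointwise form of the tail-sum formula [E T = sum_n P(n < T)]. *)
Lemma hitting_timeE w : hitting_time X a w =
  \sum_(n <oo) (\1_(unhit n) w : R)%:E.
Proof.
have partial n : n%:R%:E <= hitting_time X a w ->
    \sum_(0 <= i < n) (\1_(unhit i) w : R)%:E = n%:R%:E.
  move=> nT; rewrite big_nat (eq_bigr (fun=> (1%R : R)%:E)); last first.
    move=> i /= ni; rewrite indicE mem_set//=.
    by apply: lt_le_trans nT; rewrite lte_fin ltr_nat.
  rewrite -big_nat.
  apply: etrans (@sumEFin R nat (index_iota 0 n) xpredT (fun=> 1%R)) _.
  by rewrite sumr_const_nat subn0.
have [[k [Tk _ _]]|[Too _]] := hitting_timeP w.
  rewrite (nneseries_split 0 k)//.
  rewrite add0n partial ?Tk// eseries0 ?adde0// => i /= ki _.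
  rewrite indicE memNset// /unhit /= Tk lte_fin ltr_nat.
  by apply/negP; rewrite -leqNgt.
rewrite Too; apply/esym/eq_infty => r.
have rn := ltW (truncnS_gt r).
apply: (@le_trans _ _ ((Num.truncn r).+1%:R)%:E); first by rewrite lee_fin.
rewrite -partial ?Too ?leey//.
by apply: nneseries_lim_ge => i _; rewrite lee_fin.
Qed.

End hitting_time.

(** * Conditional expectations *)

Section conditional_expectation.
Context d (Omega : measurableType d) (R : realType).
Variables (P : probability Omega R) (G : set (set Omega)).
Hypothesis Gm : G `<=` measurable.

Local Open Scope ereal_scope.

Lemma cond_exp_measurable (Z Y : Omega -> \bar R) :
  is_cond_exp_ge0 P G Z Y -> measurable_fun setT Y.
Proof. by move=> [mY _ _] _ B mB; rewrite setTI; exact/Gm/mY. Qed.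

(** On an event [A] of [G] where [Z >= 0], the negative part of [Z] has integral
    [0] over [A], so its conditional expectation vanishes almost surely on
    [A]. *)
Lemma cond_exp_eq_positive_part (Z EZ : Omega -> \bar R) (A : set Omega) :
  measurable_fun setT Z -> is_cond_exp P G Z EZ -> G A ->
  {ae P, forall w, A w -> 0 <= Z w} ->
  exists2 Y, is_cond_exp_ge0 P G Z^\+ Y & {ae P, forall w, A w -> EZ w = Y w}.
Proof.
move=> mZ [Yp [Yn [cYp cYn EZE]]] GA Z0; exists Yp => //.
have mYn := cond_exp_measurable cYn.
have mA := Gm GA.
have [_ Yn0 Ynint] := cYn.
have : \int[P]_(w in A) `|Yn w| = 0.
  under eq_integral do rewrite gee0_abs//.
  rewrite Ynint// -(integral0 P A); apply: ge0_ae_eq_integral => //.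
  - by apply: measurable_funTS; exact: measurable_funeneg.
  - apply: filterS Z0 => w /[swap] Aw /(_ Aw) Zw.
    by rewrite funenegE /= max_r// leeNl oppe0.
move/(ae_eq_integral_abs P mA (measurable_funTS mYn)).
by apply: filterS => w /[swap] Aw /(_ Aw) Yw; rewrite EZE Yw sube0.
Qed.

End conditional_expectation.

(** The difference [f - g] is positive on [A] and has integral at most [0]. *)
Lemma null_of_integral_le d (T : measurableType d) (R : realType)
    (mu : {measure set T -> \bar R}) (A : set T) (f : T -> \bar R)
    (g : T -> R) :
  measurable A -> measurable_fun A f -> measurable_fun A g ->
  (forall x, A x -> 0 <= g x) ->
  (forall x, A x -> (g x)%:E < f x)%E ->
  (\int[mu]_(x in A) (g x)%:E < +oo)%E ->
  (\int[mu]_(x in A) f x <= \int[mu]_(x in A) (g x)%:E)%E ->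
  {ae mu, forall x, ~ A x}.
Proof.
move=> mA mf mg g0 gf gfin.
have mg' : measurable_fun A (EFin \o g) by exact/measurable_EFinP.
have mfg : measurable_fun A (fun x => f x - (g x)%:E)%E.
  exact: emeasurable_funB.
have fg0 x : A x -> (0 <= f x - (g x)%:E)%E.
  by move=> Ax; rewrite sube_ge0// ltW// gf.
rewrite (eq_integral (fun x => (f x - (g x)%:E) + (g x)%:E)%E); last first.
  by move=> x _; rewrite subeK.
rewrite ge0_integralD//.
rewrite -[leRHS]add0e leeD2rE; last first.
  by rewrite ge0_fin_numE//; apply: integral_ge0 => x Ax; rewrite lee_fin g0.
move=> fgle0; have : (\int[mu]_(x in A) `|f x - (g x)%:E| = 0)%E.
  rewrite (eq_integral (fun x => f x - (g x)%:E)%E); last first.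
    by move=> x /[!inE] Ax; rewrite gee0_abs// fg0.
  by apply/le_anti; rewrite fgle0 integral_ge0.
move/(ae_eq_integral_abs mu mA mfg) => fg_eq0.
apply: filterS fg_eq0 => x + Ax => /(_ Ax)/= fgx.
by have := gf _ Ax; rewrite -sube_gt0 fgx ltxx.
Qed.

(** * The natural filtration of the process *)

Section natural_filtration.
Context d (Omega : measurableType d) (R : realType) (P : probability Omega R).
Variables (X : nat -> {RV P >-> R}) (a : R).

(** The sample space with [sigma_upto X t] as its measurable sets; measurability
    with respect to the history is measurability on this type. *)
Definition history (t : nat) : Type := g_sigma_algebraType
  (\big[setU/set0]_(i < t.+1) preimage_set_system setT (X i) measurable).

HB.instance Definition _ t := Measurable.on (history t).

Lemma sigma_upto_preimage i t (B : set R) : (i <= t)%N -> measurable B ->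
  sigma_upto X t (X i @^-1` B).
Proof.
move=> it mB; apply: sub_sigma_algebra.
rewrite (bigD1 (Ordinal (it : (i < t.+1)%N)))//=; left.
by exists B => //; rewrite setTI.
Qed.

Lemma sigma_upto_min t (M : set (set Omega)) : sigma_algebra setT M ->
  (forall i B, (i <= t)%N -> measurable B -> M (X i @^-1` B)) ->
  sigma_upto X t `<=` M.
Proof.
move=> sM XM; apply: smallest_sub => //.
elim/big_ind : _ => [A //|A B sA sB|i _]; first by rewrite subUset.
by move=> _ [B mB <-]; rewrite setTI; apply: XM => //; rewrite -ltnS.
Qed.

Lemma sigma_upto_measurable t : sigma_upto X t `<=` measurable.
Proof.
apply: sigma_upto_min; first exact: sigma_algebra_measurable.
by move=> i B _ mB; rewrite -[_ @^-1` _]setTI; exact: measurable_funP.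
Qed.

Lemma sigma_upto_mono s t : (s <= t)%N -> sigma_upto X s `<=` sigma_upto X t.
Proof.
move=> st; apply: sigma_upto_min; first exact: smallest_sigma_algebra.
by move=> i B si; apply: sigma_upto_preimage; exact: leq_trans st.
Qed.

Lemma measurable_history t :
  measurable_fun setT (fun w : Omega => w : history t).
Proof. by move=> _ A mA; rewrite setTI; exact: sigma_upto_measurable mA. Qed.

Lemma measurable_history_process i t : (i <= t)%N ->
  measurable_fun setT (X i : history t -> R).
Proof. by move=> it _ B mB; rewrite setTI; exact: sigma_upto_preimage. Qed.

Lemma sigma_upto_unhit t : sigma_upto X t (unhit X a t).
Proof.
have -> : unhit X a t = \bigcap_(i in `I_t.+1) X i @^-1` `]a, +oo[%classic.
  apply/seteqP; split=> w /=.
    by move=> /lt_hitting_timeP Xa i /= it; rewrite in_itv/= andbT; exact: Xa.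
  move=> Xa; apply/lt_hitting_timeP => m mt.
  by have := Xa m mt; rewrite /= in_itv/= andbT.
apply: (@fin_bigcap_measurable _ (history t)) => // i it.
by apply: sigma_upto_preimage => //; rewrite -ltnS.
Qed.

Lemma measurable_unhit t : measurable (unhit X a t).
Proof. by apply: (@sigma_upto_measurable t); exact: sigma_upto_unhit. Qed.

Lemma measurable_hitting_time : measurable_fun setT (hitting_time X a).
Proof.
rewrite (_ : hitting_time X a =
  fun w => (\sum_(n <oo) (\1_(unhit X a n) w : R)%:E)%E).
  apply: ge0_emeasurable_sum => // n _.
  apply/measurable_EFinP; apply: measurable_indic; exact: measurable_unhit.
by apply/funext => w; exact: hitting_timeE.
Qed.

End natural_filtration.

(** * Summing the drift up to the hitting time *)

(** [Y t] is a finite-valued version of [E[X_{t+1} | X_0, ..., X_t]] on the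
    event [t < T]. *)
Section drift.
Context d (Omega : measurableType d) (R : realType) (P : probability Omega R).
Variables (X : nat -> {RV P >-> R}) (a : R) (phi : R -> R).
Variable Y : nat -> Omega -> R.
Hypotheses (a0 : 0 <= a) (phi_ge0 : forall z, 0 <= phi z).
Hypothesis phi_ni : forall z1 z2, z1 <= z2 -> phi z2 <= phi z1.
Hypothesis mY : forall t, measurable_fun setT (Y t).
Hypothesis Y_ge0 : forall t w, 0 <= Y t w.
Hypothesis aX : forall t, {ae P, forall w, unhit X a t w -> a <= X t.+1 w}.
Hypothesis drift : forall t, {ae P, forall w, unhit X a t w ->
  phi (X t w) * Y t w + 1 <= phi (X t w) * X t w}.

Local Open Scope ereal_scope.

Hypothesis YE : forall t A, sigma_upto X t A -> A `<=` unhit X a t ->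
  \int[P]_(w in A) (Y t w)%:E = \int[P]_(w in A) (Num.max (X t.+1 w) 0)%:E.

(** Induction on [n], by [potential_drift] on the event [A /\ {n < T}].  The
    finiteness of the first integral is carried along because that step
    cancels it; the bound on [X_0] starts the induction. *)
Lemma partial_hitting_time_le (k : R) (A : set Omega) n : sigma_upto X 0 A ->
  (forall w, A w -> (X 0%N w <= k)%R) ->
  \int[P]_(w in A `&` unhit X a n) (X n w)%:E < +oo /\
  \sum_(0 <= t < n) P (A `&` unhit X a t) +
    \int[P]_(w in A `&` unhit X a n) (potential phi a (X n w))%:E <=
    \int[P]_(w in A) (potential phi a (X 0%N w))%:E.
Proof.
move=> sA Ak; pose L t := A `&` unhit X a t.
have sL t : sigma_upto X t (L t).
  apply: (@measurableI _ (history X t)); last exact: sigma_upto_unhit.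
  exact: sigma_upto_mono sA.
have Xgt t w : unhit X a t w -> (a < X t w)%R := @unhit_gt _ _ X a t w.
have mA : measurable A := sigma_upto_measurable sA.
have mL t : measurable (L t) := sigma_upto_measurable (sL t).
have mX t : measurable_fun setT (X t) by exact: measurable_funP.
have mpot t : measurable_fun setT (fun w => potential phi a (X t w)).
  by apply: measurableT_comp; first exact: measurable_potential.
have pot0 z : (0 <= potential phi a z)%R by exact: potential_ge0.
have max0 (z : R) : (0 <= Num.max z 0)%R by rewrite le_max lexx orbT.
have mmax t : measurable_fun setT (fun w => Num.max (X t w) 0)%R.
  exact: measurable_maxr.
elim: n => [|n [Xn_fin IH]].
  split; last first.
    rewrite big_geq// add0e; apply: ge0_subset_integral => //.
    - exact: mL.
    - exact/measurable_EFinP/measurable_funTS.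
    - by move=> w _; rewrite lee_fin.
  apply: (@le_lt_trans _ _ (\int[P]_(w in L 0%N) k%:E)).
    apply: ge0_le_integral => //.
    - exact: mL.
    - by move=> w [_ /Xgt/ltW aw]; rewrite lee_fin (le_trans a0).
    - exact/measurable_EFinP/measurable_funTS.
    - by move=> w [Aw _]; rewrite lee_fin Ak.
  rewrite integral_cst//.
  by rewrite ltey_eq fin_numM//; apply: fin_num_measure; exact: mL.
have drift_n : {ae P, forall w, L n w ->
    (phi (X n w) * Y n w + 1 <= phi (X n w) * X n w)%R}.
  by apply: filterS (drift n) => w dw [_ /dw].
have aX_n : {ae P, forall w, L n w -> (a <= X n.+1 w)%R}.
  by apply: filterS (aX n) => w aw [_ /aw].
have YE_n B : measurable (B : set (history X n)) -> B `<=` L n ->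
    \int[P]_(w in B) (Y n w)%:E = \int[P]_(w in B) (Num.max (X n.+1 w) 0)%:E.
  by move=> mB BL; apply: YE => // w /BL[].
have aL w : L n w -> (a <= X n w)%R by move=> [_ /Xgt/ltW].
have Y_le : {ae P, forall w, L n w -> (Y n w <= X n w)%R}.
  apply: filterS drift_n => w dw /dw {}dw; rewrite leNgt; apply/negP => XY.
  have : (0 <= phi (X n w) * (Y n w - X n w))%R.
    by rewrite mulr_ge0// subr_ge0 ltW.
  by move: dw; lra.
have LS : L n.+1 `<=` L n.
  by move=> w [Aw uw]; split => //; exact: (@unhitS _ _ X a n).
have mV := @measurable_history _ _ _ P X n.
have mXn := @measurable_history_process _ _ _ P X n n (leqnn n).
split.
  have := integral_nonincrease mV (sL n) a0 mXn (mY n) (Y_ge0 n) YE_n aL Y_le.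
  move=> /le_lt_trans/(_ Xn_fin); apply: le_lt_trans.
  rewrite (eq_integral (fun w => (Num.max (X n.+1 w) 0)%:E)); last first.
    move=> w /[!inE] -[_ uw].
    by rewrite max_l// (le_trans a0)// ltW// (Xgt n.+1).
  apply: ge0_subset_integral => //.
  - exact: mL.
  - exact: mL.
  - exact/measurable_EFinP/measurable_funTS.
  - by move=> w _; rewrite lee_fin.
apply: le_trans IH.
rewrite big_nat_recr; last exact: leq0n.
rewrite -addeA; apply: leeD2l.
have := potential_drift mV (sL n) a0 phi_ge0 phi_ni mXn (mX n.+1) (mY n)
  (Y_ge0 n) YE_n aL aX_n drift_n Xn_fin.
apply: le_trans; rewrite leeD2l//.
apply: ge0_subset_integral => //.
- exact: mL.
- exact: mL.
- exact/measurable_EFinP/measurable_funTS.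
- by move=> w _; rewrite lee_fin.
Qed.

Lemma integral_hitting_time_le (k : R) (A : set Omega) : sigma_upto X 0 A ->
  (forall w, A w -> (X 0%N w <= k)%R) ->
  \int[P]_(w in A) hitting_time X a w <=
  \int[P]_(w in A) (potential phi a (X 0%N w))%:E.
Proof.
move=> sA Ak; have mA : measurable A := sigma_upto_measurable sA.
under eq_integral do rewrite hitting_timeE.
rewrite integral_nneseries//; last first.
  move=> n; apply/measurable_EFinP/measurable_funTS.
  by apply: measurable_indic; exact: measurable_unhit.
apply: lime_le.
  apply: is_cvg_nneseries => n _ _.
  by apply: integral_ge0 => w _; rewrite lee_fin.
apply: nearW => n; have [_] := partial_hitting_time_le n sA Ak.
apply: le_trans; rewrite (eq_bigr (fun t => P (A `&` unhit X a t))).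
  by rewrite leeDl// integral_ge0// => w _; rewrite lee_fin potential_ge0.
move=> t _; rewrite (integral_indic _ mA); last exact: measurable_unhit.
by rewrite setIC.
Qed.

End drift.

(** * The reciprocal of the drift *)

Section reciprocal_drift.
Variables (R : realType) (D : set R) (h : R -> R) (a : R).
Hypotheses (D_itv : is_interval D) (Da : D a).
Hypothesis h_gt0 : forall x, D x -> 0 < h x.
Hypothesis h_mono : forall x y, D x -> D y -> x <= y -> h x <= h y.

(** An extension of [1 / h] to the whole line which is still nonnegative and
    nonincreasing, hence measurable, whatever [h] is outside [D]: it is constant
    below [a] and [0] above [D]. *)
Definition inv_drift (x : R) : R :=
  if Num.max a x \in D then (h (Num.max a x))^-1 else 0.

Lemma inv_driftE x : D x -> a <= x -> inv_drift x = (h x)^-1.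
Proof. by move=> Dx ax; rewrite /inv_drift max_r// mem_set. Qed.

Lemma inv_drift_ge0 x : 0 <= inv_drift x.
Proof.
by rewrite /inv_drift; case: ifP => // /[!inE] Dx; rewrite invr_ge0 ltW// h_gt0.
Qed.

Lemma inv_drift_ni x y : x <= y -> inv_drift y <= inv_drift x.
Proof.
move=> xy; rewrite {1}/inv_drift.
case: ifP => [/[!inE] Dy|_]; last exact: inv_drift_ge0.
have mxy : Num.max a x <= Num.max a y by rewrite ge_max !le_max lexx xy orbT.
have Dx : D (Num.max a x).
  by apply: D_itv Da Dy _ _; rewrite mxy le_max lexx.
by rewrite /inv_drift mem_set// lef_pV2 ?posrE ?h_gt0// h_mono.
Qed.

Lemma inv_drift_potentialE x : D x ->
  ((potential inv_drift a x)%:E =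
   \int[lebesgue_measure]_(z in `[a, x]) ((h z)^-1)%:E)%E.
Proof.
move=> Dx; rewrite (potentialE a inv_drift_ge0 inv_drift_ni).
apply: eq_integral => z; rewrite inE/= in_itv/= => /andP[az zx].
by rewrite inv_driftE//; apply: D_itv Da Dx _ _; rewrite az.
Qed.

End reciprocal_drift.

Section drift_domain.
Variables (Omega : Type) (R : realType) (X : nat -> Omega -> R) (a : R).

Lemma drift_domain_is_interval : is_interval (drift_domain X a).
Proof.
move=> x y Dx Dy z xzy I [I_itv aI].
have Ix : I x by apply: Dx.
have Iy : I y by apply: Dy.
exact: (I_itv x y Ix Iy).
Qed.

Lemma drift_domain_min : drift_domain X a a.
Proof. by move=> I [_ aI]; apply: aI; left. Qed.

Lemma drift_domain_value t w :
  (t%:R%:E <= hitting_time X a w)%E -> a <= X t w -> drift_domain X a (X t w).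
Proof. by move=> tT aX I [_ vI]; apply: vI; right; split=> //; exists w, t. Qed.

End drift_domain.

Theorem theorem10 (d : measure_display) (Omega : measurableType d)
    (R : realType) (P : probability Omega R)
    (X : nat -> {RV P >-> R}) (xmin : R) (h : R -> R)
    (EX : nat -> Omega -> \bar R) (ET : Omega -> \bar R)
    (T := hitting_time X xmin) (D := drift_domain X xmin)
    (xmin_ge0 : 0 <= xmin)
    (* condition (a) *)
    (X_ge : forall t : nat,
       {ae P, forall w, ((t%:R)%:E <= T w)%E -> xmin <= X t w})
    (* condition (b): h : D -> R^+ is monotonically increasing, and EX t is
       E[X_{t+1} | X_0, ..., X_t] *)
    (h_gt0 : forall x, D x -> 0 < h x)
    (h_mono : forall x y, D x -> D y -> x <= y -> h x <= h y)
    (EX_cond_exp : forall t : nat,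
       is_cond_exp P (sigma_upto X t) (fun w => (X t.+1 w)%:E) (EX t))
    (drift : forall t : nat,
       {ae P, forall w, ((t%:R)%:E < T w)%E ->
          ((h (X t w))%:E <= (X t w)%:E - EX t w)%E})
    (* ET is E[T | X_0] *)
    (ET_cond_exp : is_cond_exp P (sigma_upto X 0) T ET) :
  {ae P, forall w,
     (ET w <= \int[lebesgue_measure]_(z in `[xmin, X 0%N w]) ((h z)^-1)%:E)%E}.
Proof.
have D_itv : is_interval D := @drift_domain_is_interval _ _ _ _.
have Dmin : D xmin := @drift_domain_min _ _ _ _.
pose phi := inv_drift D h xmin.
have phi_ge0 : forall z, 0 <= phi z := inv_drift_ge0 xmin h_gt0.
have phi_ni : forall x y, x <= y -> phi y <= phi x :=
  inv_drift_ni D_itv Dmin h_gt0 h_mono.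
have aX t : {ae P, forall w, unhit X xmin t w -> xmin <= X t.+1 w}.
  by apply: filterS (X_ge t.+1) => w Xw uw; exact/Xw/lt_hitting_time_le.
have gX t w : unhit X xmin t w -> xmin < X t w /\ D (X t w).
  move=> uw; split; first exact: unhit_gt uw.
  apply: drift_domain_value; first exact: ltW uw.
  by apply/ltW; exact: unhit_gt uw.
(* the conditional expectations, made finite-valued: drift forces them to be
   finite almost surely before the hitting time *)
have /choice[Y HY] : forall t, exists Y : Omega -> R,
    [/\ measurable_fun setT Y, (forall w, 0 <= Y w),
        {ae P, forall w, unhit X xmin t w ->
           phi (X t w) * Y w + 1 <= phi (X t w) * X t w}
      & forall A, sigma_upto X t A -> A `<=` unhit X xmin t ->
        (\int[P]_(w in A) (Y w)%:E =
         \int[P]_(w in A) (Num.max (X t.+1 w) 0)%:E)%E].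
  move=> t; have sub := @sigma_upto_measurable _ _ _ P X t.
  have mXS : measurable_fun setT (fun w => (X t.+1 w)%:E).
    by apply/measurable_EFinP; exact: measurable_funP.
  have XS0 : {ae P, forall w, unhit X xmin t w -> (0 <= (X t.+1 w)%:E)%E}.
    by apply: filterS (aX t) => w aw /aw; rewrite lee_fin; exact: le_trans.
  have [Y cY EXY] := cond_exp_eq_positive_part sub mXS (EX_cond_exp t)
    (@sigma_upto_unhit _ _ _ P X xmin t) XS0.
  have mY := cond_exp_measurable sub cY.
  have [_ Y0 YI] := cY.
  have hY : {ae P, forall w, unhit X xmin t w ->
      Y w \is a fin_num /\ h (X t w) <= X t w - fine (Y w)}.
    apply: filterS2 EXY (drift t) => w EXYw dw uw; have := dw uw.
    rewrite EXYw//; have := Y0 w.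
    by case: (Y w) => [r| |].
  exists (fine \o Y); split.
  - exact: measurableT_comp.
  - by move=> w; rewrite fine_ge0.
  - apply: filterS hY => w hYw uw; have [_ {}hYw] := hYw uw.
    have [/ltW aXw DX] := gX _ _ uw.
    rewrite /phi inv_driftE// -lerBrDl -mulrBr /=.
    by rewrite -ler_pdivrMl ?invr_gt0 ?h_gt0// invrK mulr1.
  - move=> A sA Aun.
    rewrite (_ : (\int[P]_(w in A) _ = \int[P]_(w in A) Y w)%E).
      rewrite YI//; apply: eq_integral => w _.
      by rewrite funeposE /= EFin_max.
    apply: ge0_ae_eq_integral => //.
    + exact: sub.
    + by apply/measurable_EFinP/measurable_funTS; exact: measurableT_comp.
    + exact: measurable_funTS.
    + by move=> w _; rewrite lee_fin fine_ge0.
    + by apply: filterS hY => w hYw /Aun/hYw[/fineK].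
have mT : measurable_fun setT T := @measurable_hitting_time _ _ _ P X xmin.
have sub0 := @sigma_upto_measurable _ _ _ P X 0%N.
have [|E cE ETE] := cond_exp_eq_positive_part sub0 mT ET_cond_exp
  (@measurableT _ (history X 0%N)).
  by apply: aeW => w _; exact: hitting_time_ge0.
have mE := cond_exp_measurable sub0 cE.
have [mEs E0 EI] := cE.
pose G w := potential phi xmin (X 0%N w).
have mpot := measurable_potential xmin phi_ge0 phi_ni.
have mG : measurable_fun setT G by apply: measurableT_comp.
pose A (k : nat) := [set w | X 0%N w <= k%:R] `&` [set w | ((G w)%:E < E w)%E].
have sA k : sigma_upto X 0 (A k).
  apply: (@measurableI _ (history X 0%N)).
    rewrite (_ : [set w | _] = X 0%N @^-1` `]-oo, k%:R]); last first.
      by apply/seteqP; split=> w /=; rewrite in_itv.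
    exact: sigma_upto_preimage.
  rewrite -[X in measurable X]setTI.
  apply: (@emeasurable_fun_lt _ (history X 0%N)) => //.
    apply/measurable_EFinP; apply: measurableT_comp => //.
    exact: measurable_history_process.
  by move=> _ B mB; rewrite setTI; exact: mEs.
have null k : {ae P, forall w, ~ A k w}.
  have mA := sub0 _ (sA k).
  apply: (@null_of_integral_le _ _ _ _ _ E G) => //.
  - exact: measurable_funTS.
  - exact: measurable_funTS.
  - by move=> w _; exact: potential_ge0.
  - by move=> w [].
  - apply: (@le_lt_trans _ _
      (\int[P]_(w in A k) (potential phi xmin k%:R)%:E)%E).
      apply: ge0_le_integral => //.
      + by move=> w _; rewrite lee_fin potential_ge0.
      + exact/measurable_EFinP/measurable_funTS.
      + by move=> w [Xk _]; rewrite lee_fin potential_nd.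
    rewrite integral_cst// ltey_eq fin_numM//; exact: fin_num_measure.
  - have -> : (\int[P]_(w in A k) E w = \int[P]_(w in A k) T w)%E.
      rewrite EI//; apply: eq_integral => w _.
      by rewrite funeposE max_l// hitting_time_ge0.
    apply: (@integral_hitting_time_le _ _ _ P X xmin phi Y
      _ _ _ _ _ _ _ _ k%:R) => //.
    + by move=> t; have [] := HY t.
    + by move=> t; have [] := HY t.
    + by move=> t; have [] := HY t.
    + by move=> t; have [] := HY t.
    + by move=> w [].
apply: filterS3 ETE (ae_foralln null) (X_ge 0%N) => w ETw Aw Xw.
have aX0 : xmin <= X 0%N w by apply: Xw; exact: hitting_time_ge0.
rewrite -(inv_drift_potentialE D_itv Dmin h_gt0 h_mono); last first.
  by apply: drift_domain_value => //; exact: hitting_time_ge0.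
rewrite ETw// leNgt; apply/negP => GE.
apply: (Aw (Num.truncn (X 0%N w)).+1); split=> //=.
by rewrite ltW// truncnS_gt.
Qed.
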